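(* Let $T$ be a bounded linear operator on a complex Hilbert space which is coquasiposinormal. If $T$ is paranormal and $T^n$ is quasinormal for some positive integer $n$, then $T$ is normal.
   Context: $T$ is coquasiposinormal if $\mathcal{N}(T^* )\subseteq\mathcal{N}(T)$ (equivalently $\overline{\mathcal{R}(T^* )}\subseteq\overline{\mathcal{R}(T)}$), where $\mathcal{N}$ and $\mathcal{R}$ denote kernel and range. $T$ is paranormal if $\|Tx\|^2\le\|T^2x\|\,\|x\|$ for every vector $x$. An operator $A$ is quasinormal if $(A^*A-AA^* )A=O$. *)

(* Defs.v *)
From HB Require Import structures.
From mathcomp Require Import all_boot all_order all_algebra.
From mathcomp Require Import complex.
From mathcomp Require Import reals.
Set Implicit Arguments. Unset Strict Implicit. Unset Printing Implicit Defensive.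
Import Order.TTheory GRing.Theory Num.Theory.
Local Open Scope ring_scope.
Local Open Scope complex_scope.

Definition ipnorm (R : realType) (V : lmodType R[i]) (ip : V -> V -> R[i]) (x : V) : R :=
  Num.sqrt (complex.Re (ip x x)).

Record hilbert_space (R : realType) := HilbertSpace {
  hs_car :> lmodType R[i];
  hs_ip : hs_car -> hs_car -> R[i];
  hs_ipDl : forall (a : R[i]) (x y z : hs_car),
      hs_ip (a *: x + y) z = a * hs_ip x z + hs_ip y z;
  hs_ipC : forall x y : hs_car, hs_ip y x = (hs_ip x y)^*;
  hs_ip_ge0 : forall x : hs_car, 0 <= hs_ip x x;
  hs_ip_eq0 : forall x : hs_car, hs_ip x x = 0 -> x = 0;
  hs_complete : forall u : nat -> hs_car,
      (forall e : R, 0 < e -> exists N : nat, forall m n : nat,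
          (N <= m)%N -> (N <= n)%N -> ipnorm hs_ip (u m - u n) < e) ->
      exists l : hs_car, forall e : R, 0 < e -> exists N : nat, forall n : nat,
          (N <= n)%N -> ipnorm hs_ip (u n - l) < e
}.

Section Ops.
Variables (R : realType) (H : hilbert_space R).
Local Notation ip := (@hs_ip R H).
Local Notation V := (hs_car H).

Definition hnorm (x : V) : R := ipnorm ip x.

Definition bounded_op (T : V -> V) : Prop :=
  (forall (a : R[i]) (x y : V), T (a *: x + y) = a *: T x + T y) /\
  exists M : R, forall x : V, hnorm (T x) <= M * hnorm x.

Definition is_adjoint (T S : V -> V) : Prop :=
  forall x y : V, ip (T x) y = ip x (S y).

Definition coquasiposinormal (T Ts : V -> V) : Prop :=
  forall x : V, Ts x = 0 -> T x = 0.

Definition paranormal (T : V -> V) : Prop :=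
  forall x : V, hnorm (T x) ^+ 2 <= hnorm (T (T x)) * hnorm x.

Definition quasinormal (A As : V -> V) : Prop :=
  forall x : V, As (A (A x)) - A (As (A x)) = 0.

Definition normal (T Ts : V -> V) : Prop :=
  forall x : V, T (Ts x) = Ts (T x).

End Ops.

(* Main.v *)
Require Import Defs.
From HB Require Import structures.
From mathcomp Require Import all_boot all_order all_algebra.
From mathcomp Require Import complex.
From mathcomp Require Import boolp classical_sets reals.
From mathcomp Require Import ring lra.
Set Implicit Arguments. Unset Strict Implicit. Unset Printing Implicit Defensive.
Import Order.TTheory GRing.Theory Num.Theory.
Local Open Scope ring_scope.

(** Thanks to the kernel condition the quasinormal operator [A = T ^ n] is normal, so
    the vectors with [|A ^ m x| <= C r ^ m] for all m form a closed subspace that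
    reduces every operator commuting with A, in particular T (this replaces Fuglede's
    theorem), and A expands its orthogonal complement by r.  Between two such subspaces
    with nearby radii, paranormality (log-convexity of [k |-> |T ^ k x|]) bounds T from
    above and hence from below, so [T* T] is nearly scalar there and nearly commutes
    with T.  Summing over a fine geometric sequence of radii, T is quasinormal, and the
    kernel condition makes it normal.  Only [Re <x, y>] and squared norms are used. *)

(** * Elementary estimates for powers and real sequences *)

Section RealSequences.
Variable R : realType.

Lemma lt_natr_bound (x : R) : x < (Num.bound `|x|)%:R.
Proof. exact: le_lt_trans (ler_norm _) (archi_boundP (normr_ge0 _)). Qed.

Lemma bernoulli_le (h : R) k : 0 <= h -> 1 + k%:R * h <= (1 + h) ^+ k.
Proof.
move=> h0; elim: k => [|k IH]; first by rewrite mul0r addr0 expr0.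
rewrite exprS.
have : (1 + h) * (1 + k%:R * h) <= (1 + h) * (1 + h) ^+ k.
  by rewrite ler_wpM2l // addr_ge0.
have k0 : 0 <= k%:R :> R by [].
rewrite -natr1; nra.
Qed.

Lemma exp_unbounded (c a : R) : 1 < a -> exists k, c < a ^+ k.
Proof.
move=> a1; have h0 : 0 < a - 1 by rewrite subr_gt0.
exists (Num.bound `|c / (a - 1)|).
have := bernoulli_le (Num.bound `|c / (a - 1)|) (ltW h0).
have := lt_natr_bound (c / (a - 1)).
rewrite ltr_pdivrMr // [1 + (a - 1)]addrC subrK; lra.
Qed.

Lemma exp_small (e a : R) : 0 < e -> 0 < a -> a < 1 -> exists k, a ^+ k < e.
Proof.
move=> e0 a0 a1.
have [|k hk] := @exp_unbounded e^-1 a^-1; first by rewrite invf_gt1.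
by exists k; move: hk; rewrite exprVn ltf_pV2 ?posrE // exprn_gt0.
Qed.

Lemma one_minus_exp (e : R) k : 0 <= e <= 1 -> 1 - (1 - e) ^+ k <= k%:R * e.
Proof.
move=> /andP[e0 e1]; elim: k => [|k IH]; first by rewrite expr0 subrr mul0r.
have : 0 <= (1 - e) ^+ k <= 1.
  by rewrite exprn_ge0 ?exprn_ile1 ?subr_ge0 // lerBlDr lerDl.
move=> /andP[p0 p1]; rewrite exprS -natr1; nra.
Qed.

(** Log-convexity makes the ratios of consecutive terms nondecreasing, so all of them stay at least
    [t]. Positivity is carried through the induction to allow cancellation. *)
Lemma logconvex_geometric (a : nat -> R) (t : R) :
  (forall k, a k.+1 ^+ 2 <= a k.+2 * a k) -> 0 < t -> 0 < a 0 ->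
  t * a 0 <= a 1 -> forall k, t ^+ k * a 0 <= a k.
Proof.
move=> lc t0 a0 a1 k.
suff H : 0 < a k /\ t * a k <= a k.+1 /\ t ^+ k * a 0 <= a k by case: H => _ [].
elim: k => [|k [p [q r]]]; first by rewrite expr0 mul1r.
have p' : 0 < a k.+1 by apply: lt_le_trans q; rewrite mulr_gt0.
split=> //; split.
  have h := lc k.
  rewrite -(ler_pM2r p); apply: le_trans h.
  by rewrite expr2 -mulrA [a k.+1 * a k]mulrC mulrA ler_pM2r.
by apply: le_trans q; rewrite exprS -mulrA ler_pM2l.
Qed.

Lemma nondecreasing_cauchy (a : nat -> R) (c : R) :
  (forall j k, (j <= k)%N -> a j <= a k) -> (forall k, a k <= c) ->
  forall e, 0 < e -> exists N, forall k, (N <= k)%N -> a k - a N < e.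
Proof.
move=> mono ub e e0.
pose E : set R := [set a k | k in setT]%classic.
have supE : has_sup E.
  by split; [exists (a 0), 0 | exists c => _ [k _ <-]].
have [_ [N _ <-] hN] := sup_adherent e0 supE.
exists N => k _.
have : a k <= sup E by apply: ub_le_sup; [case: supE | exists k].
lra.
Qed.

End RealSequences.

(** * Real Hilbert spaces: inner product, limits, adjoints, projections *)

Record real_hilbert (R : realType) := RealHilbert {
  rh_car :> lmodType R;
  rh_dot : rh_car -> rh_car -> R;
  rh_dotP : forall (a : R) (x y z : rh_car),
    rh_dot (a *: x + y) z = a * rh_dot x z + rh_dot y z;
  rh_dotC : forall x y : rh_car, rh_dot y x = rh_dot x y;
  rh_dot_ge0 : forall x : rh_car, 0 <= rh_dot x x;
  rh_dot_eq0 : forall x : rh_car, rh_dot x x = 0 -> x = 0;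
  rh_complete : forall u : nat -> rh_car,
    (forall e : R, 0 < e -> exists N : nat, forall m n : nat,
      (N <= m)%N -> (N <= n)%N -> rh_dot (u m - u n) (u m - u n) < e) ->
    exists l : rh_car, forall e : R, 0 < e -> exists N : nat, forall n : nat,
      (N <= n)%N -> rh_dot (u n - l) (u n - l) < e
}.

Section InnerProduct.
Variables (R : realType) (V : real_hilbert R).
Local Notation dot := (@rh_dot R V).
Implicit Types (x y z : V) (T S A As : V -> V) (u : nat -> V).

Definition sqn x : R := dot x x.
Definition cvg_to u l := forall e : R, 0 < e ->
  exists N : nat, forall n : nat, (N <= n)%N -> sqn (u n - l) < e.

Lemma dotC x y : dot y x = dot x y. Proof. exact: rh_dotC. Qed.

Lemma dotDl x y z : dot (x + y) z = dot x z + dot y z.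
Proof. by rewrite -[x]scale1r rh_dotP mul1r scale1r. Qed.

Lemma dot0l z : dot 0 z = 0.
Proof. by have := dotDl 0 0 z; rewrite addr0; lra. Qed.

Lemma dotZl a x z : dot (a *: x) z = a * dot x z.
Proof. by rewrite -[a *: x]addr0 rh_dotP dot0l addr0. Qed.

Lemma dotNl x z : dot (- x) z = - dot x z.
Proof. by rewrite -scaleN1r dotZl mulN1r. Qed.

Lemma dot0r z : dot z 0 = 0. Proof. by rewrite dotC dot0l. Qed.
Lemma dotDr x y z : dot z (x + y) = dot z x + dot z y.
Proof. by rewrite !(dotC _ z) dotDl. Qed.
Lemma dotZr a x z : dot z (a *: x) = a * dot z x.
Proof. by rewrite !(dotC _ z) dotZl. Qed.
Lemma dotNr x z : dot z (- x) = - dot z x.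
Proof. by rewrite !(dotC _ z) dotNl. Qed.

Definition dotE := (dotDl, dotDr, dotNl, dotNr, dotZl, dotZr, dot0l, dot0r).

Lemma sqn_ge0 x : 0 <= sqn x. Proof. exact: rh_dot_ge0. Qed.
Lemma sqn_eq0 x : sqn x = 0 -> x = 0. Proof. exact: rh_dot_eq0. Qed.
Lemma sqn0 : sqn 0 = 0. Proof. exact: dot0l. Qed.
Lemma sqnZ a x : sqn (a *: x) = a ^+ 2 * sqn x.
Proof. by rewrite /sqn !dotE; ring. Qed.
Lemma sqnN x : sqn (- x) = sqn x.
Proof. by rewrite /sqn !dotE opprK. Qed.
Lemma sqnD x y : sqn (x + y) = sqn x + 2 * dot x y + sqn y.
Proof. by rewrite /sqn !dotE (dotC x y); ring. Qed.
Lemma sqnB x y : sqn (x - y) = sqn x - 2 * dot x y + sqn y.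
Proof. by rewrite /sqn !dotE (dotC x y); ring. Qed.
Lemma sqn_distC x y : sqn (x - y) = sqn (y - x).
Proof. by rewrite -opprB sqnN. Qed.

Lemma sqnD_le x y : sqn (x + y) <= 2 * sqn x + 2 * sqn y.
Proof. by have := sqn_ge0 (x - y); rewrite sqnB sqnD; lra. Qed.

Lemma dot_inj x y : (forall z, dot x z = dot y z) -> x = y.
Proof.
move=> h; apply/eqP; rewrite -subr_eq0; apply/eqP/sqn_eq0.
by rewrite /sqn dotDl dotNl h subrr.
Qed.

Lemma cauchy_schwarz x y : dot x y ^+ 2 <= sqn x * sqn y.
Proof.
have [y0|y0] := eqVneq (sqn y) 0.
  by rewrite (sqn_eq0 y0) dot0r sqn0 mulr0 expr0n.
have yp : 0 < sqn y by rewrite lt_neqAle eq_sym y0 sqn_ge0.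
have := sqn_ge0 (sqn y *: x - dot x y *: y).
rewrite sqnB !sqnZ dotZl dotZr => h.
rewrite -(ler_pM2l yp); lra.
Qed.

Lemma cvg_to_uniq u l m : cvg_to u l -> cvg_to u m -> l = m.
Proof.
move=> ul um; apply/eqP; rewrite -subr_eq0; apply/eqP/sqn_eq0.
apply/eqP; rewrite eq_le sqn_ge0 andbT; apply/ler_addgt0Pl => e e0.
have e4 : 0 < e / 4 by lra.
have [N1 h1] := ul _ e4; have [N2 h2] := um _ e4.
have := h1 _ (leq_maxl N1 N2); have := h2 _ (leq_maxr N1 N2).
set w := u _ => q1 q2.
have -> : l - m = (l - w) + (w - m) by rewrite addrA subrK.
have := sqnD_le (l - w) (w - m); rewrite (sqn_distC l w); lra.
Qed.

Lemma cvg_to_ext u v l : (forall n, u n = v n) -> cvg_to u l -> cvg_to v l.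
Proof. by move=> uv h e /h[N hN]; exists N => n; rewrite -uv; exact: hN. Qed.

Lemma cvg_toD u v l m :
  cvg_to u l -> cvg_to v m -> cvg_to (fun n => u n + v n) (l + m).
Proof.
move=> ul vm e e0; have e4 : 0 < e / 4 by lra.
have [N1 h1] := ul _ e4; have [N2 h2] := vm _ e4.
exists (maxn N1 N2) => n; rewrite geq_max => /andP[/h1 q1 /h2 q2].
have -> : u n + v n - (l + m) = (u n - l) + (v n - m) by rewrite opprD addrACA.
have := sqnD_le (u n - l) (v n - m); lra.
Qed.

Lemma cvg_to_bnd u v l m c : 0 <= c ->
  (forall n, sqn (v n - m) <= c * sqn (u n - l)) -> cvg_to u l -> cvg_to v m.
Proof.
move=> c0 h ul e e0.
have [|N hN] := ul (e / (c + 1)); first by rewrite divr_gt0 //; lra.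
exists N => n /hN; rewrite ltr_pdivlMr; last lra.
have := h n; have := sqn_ge0 (u n - l); nra.
Qed.

Lemma cvg_toZ a u l : cvg_to u l -> cvg_to (fun n => a *: u n) (a *: l).
Proof.
apply: (@cvg_to_bnd _ _ _ _ (a ^+ 2)) => [|n]; first exact: sqr_ge0.
by rewrite -scalerBr sqnZ.
Qed.

Lemma cvg_to_cst l : cvg_to (fun=> l) l.
Proof. by move=> e e0; exists 0%N => n _; rewrite subrr sqn0. Qed.

Lemma cvg_to_dotP u l y : cvg_to u l -> forall e : R, 0 < e ->
  exists N, forall n, (N <= n)%N -> `|dot (u n) y - dot l y| < e.
Proof.
move=> ul e e0; have y0 := sqn_ge0 y.
have e2 : 0 < e ^+ 2 by rewrite exprn_gt0.
have [|N hN] := ul (e ^+ 2 / (sqn y + 1)); first by rewrite divr_gt0 //; lra.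
exists N => n /hN; rewrite ltr_pdivlMr; last lra.
have := cauchy_schwarz (u n - l) y; have := sqn_ge0 (u n - l).
rewrite dotDl dotNl; set d := dot _ y - _ => h1 h2 h3.
have d2 : d ^+ 2 < e ^+ 2 by nra.
by rewrite ltr_norml; apply/andP; split; rewrite ltNge; apply/negP => h; nra.
Qed.

Lemma cvg_to_dot_sym u v l m x y : cvg_to u l -> cvg_to v m ->
  (forall n, dot (u n) y = dot (v n) x) -> dot l y = dot m x.
Proof.
move=> ul vm h; apply/eqP; rewrite -subr_eq0 -normr_eq0 eq_le normr_ge0 andbT.
apply/ler_addgt0Pl => e e0; have e2 : 0 < e / 2 by lra.
have [N1 h1] := cvg_to_dotP y ul e2; have [N2 h2] := cvg_to_dotP x vm e2.
have := h1 _ (leq_maxl N1 N2); have := h2 _ (leq_maxr N1 N2).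
rewrite h; set w := dot (v _) x => q2 q1.
have -> : dot l y - dot m x = (dot l y - w) + (w - dot m x).
  by rewrite addrA subrK.
apply: le_trans (ler_normD _ _) _; rewrite [X in X + _]distrC; lra.
Qed.

Lemma cvg_to_dot u l y c :
  cvg_to u l -> (forall n, dot (u n) y <= c) -> dot l y <= c.
Proof.
move=> ul h; apply/ler_addgt0Pl => e e0.
have [N hN] := cvg_to_dotP y ul e0.
by have := hN N (leqnn N); rewrite ltr_norml => /andP[+ _]; have := h N; lra.
Qed.

(** Expanding [0 <= sqn (u n - l)] gives [dot (u n) l <= (c + sqn l) / 2]; the limit of the left
    side is [sqn l]. *)
Lemma cvg_to_sqn u l c : cvg_to u l -> (forall n, sqn (u n) <= c) -> sqn l <= c.
Proof.
move=> ul h; have c0 : 0 <= c := le_trans (sqn_ge0 _) (h 0%N).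
have := @cvg_to_dot u l l ((c + sqn l) / 2) ul.
rewrite -/(sqn l) => H.
suff : sqn l <= (c + sqn l) / 2 by lra.
apply: H => n; have := sqn_ge0 (u n - l); rewrite sqnB; have := h n; lra.
Qed.

(** Operators are bare functions: having an adjoint already forces linearity, as [adjD] and [adjZ]
    show. *)
Definition adj T S := forall x y, dot (T x) y = dot x (S y).

Lemma adjC T S : adj T S -> adj S T.
Proof. by move=> h x y; rewrite dotC -h dotC. Qed.

Lemma adj_iter T S n : adj T S -> adj (iter n T) (iter n S).
Proof. by move=> h; elim: n => [|n IH] x y //; rewrite iterSr IH h. Qed.

Lemma adjD T S : adj T S -> forall x y, T (x + y) = T x + T y.
Proof. by move=> h x y; apply: dot_inj => z; rewrite dotDl !h dotDl. Qed.
Lemma adjZ T S : adj T S -> forall a x, T (a *: x) = a *: T x.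
Proof. by move=> h a x; apply: dot_inj => z; rewrite dotZl !h dotZl. Qed.
Lemma adj0 T S : adj T S -> T 0 = 0.
Proof. by move=> h; apply: dot_inj => z; rewrite h !dot0l. Qed.
Lemma adjN T S : adj T S -> forall x, T (- x) = - T x.
Proof. by move=> h x; apply: dot_inj => z; rewrite dotNl !h dotNl. Qed.
Lemma adjB T S : adj T S -> forall x y, T (x - y) = T x - T y.
Proof. by move=> h x y; rewrite (adjD h) (adjN h). Qed.

Lemma sqn_adj T S : adj T S -> forall x, sqn (T x) = dot (S (T x)) x.
Proof. by move=> h x; rewrite /sqn h dotC. Qed.

(** The constant bounds the square of the operator norm. *)
Definition bnd (c : R) T := forall x, sqn (T x) <= c * sqn x.

Lemma bnd_iter c T : 0 <= c -> bnd c T -> forall n, bnd (c ^+ n) (iter n T).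
Proof.
move=> c0 h; elim=> [|n IH] x; first by rewrite expr0 mul1r.
rewrite iterS; apply: le_trans (h _) _.
by rewrite exprS -mulrA ler_wpM2l.
Qed.

(** Since [sqn (S x) = dot (T (S x)) x], Cauchy-Schwarz bounds its square by
    [c * sqn (S x) * sqn x], and one factor [sqn (S x)] cancels. *)
Lemma bnd_adj c T S : 0 <= c -> adj T S -> bnd c T -> bnd c S.
Proof.
move=> c0 h b x; have h' := adjC h.
have [y0|y0] := eqVneq (sqn (S x)) 0; first by rewrite y0 mulr_ge0 ?sqn_ge0.
have yp : 0 < sqn (S x) by rewrite lt_neqAle eq_sym y0 sqn_ge0.
have := cauchy_schwarz (T (S x)) x; rewrite -(sqn_adj h').
have := b (S x); have := sqn_ge0 x => h1 h2 h3.
rewrite -(ler_pM2l yp); nra.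
Qed.

Lemma cvg_to_op c T S u l :
  0 <= c -> adj T S -> bnd c T -> cvg_to u l -> cvg_to (T \o u) (T l).
Proof.
move=> c0 h b; apply: (cvg_to_bnd c0) => n /=.
by rewrite -(adjB h).
Qed.

(* The Cauchy-Schwarz argument for the form [dot (B _) _], run at [x - B x / d]. *)
Lemma sqn_form_le (K : V -> Prop) B d : 0 < d -> adj B B ->
  (forall x, K x -> K (B x)) -> (forall x, K x -> K (x - d^-1 *: B x)) ->
  (forall x, K x -> 0 <= dot (B x) x <= d * sqn x) ->
  forall x, K x -> sqn (B x) <= d * dot (B x) x.
Proof.
move=> d0 h KB KD b x Kx.
have /andP[_ b1] := b _ (KB _ Kx).
have /andP[b2 _] := b _ (KD _ Kx).
move: b2; rewrite (adjB h) (adjZ h) !dotE (h (B x) x) -/(sqn (B x)).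
set s := sqn (B x) in b1 *; set t := dot (B (B x)) _ in b1 *.
move=> b2.
have e : d * d^-1 = 1 by rewrite divff // gt_eqF.
have i0 : 0 < d^-1 by rewrite invr_gt0.
have : d^-1 * (d^-1 * t) <= d^-1 * s.
  by rewrite ler_pM2l // -(ler_pM2l d0) mulrA e mul1r.
move=> b3.
have : 0 <= dot (B x) x - d^-1 * s by lra.
rewrite -(pmulr_rge0 _ d0) mulrBr mulrA e mul1r; lra.
Qed.

(** A sequence in M minimizing the distance to x is Cauchy; its limit attains the distance, and
    minimality forces orthogonality. *)
Lemma projection (M : V -> Prop) :
  M 0 -> (forall x y, M x -> M y -> M (x + y)) -> (forall a x, M x -> M (a *: x)) ->
  (forall u l, (forall n, M (u n)) -> cvg_to u l -> M l) ->
  forall x, exists2 y, M y & forall z, M z -> dot (x - y) z = 0.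
Proof.
move=> M0 MD MZ Mcl x.
pose E : set R := [set sqn (x - z) | z in [set z | M z]]%classic.
have infE : has_inf E.
  by split; [exists (sqn (x - 0)), 0 | exists 0 => _ [z _ <-]; exact: sqn_ge0].
have lbE z : M z -> inf E <= sqn (x - z).
  by move=> Mz; apply: ge_inf; [case: infE | exists z].
have : forall n : nat, exists z, M z /\ sqn (x - z) < inf E + n.+1%:R^-1.
  move=> n; have [|_ [z Mz <-] hz] := @inf_adherent _ E (n.+1%:R^-1) _ infE.
    by rewrite invr_gt0.
  by exists z.
move/choice => [u hu].
have cau : forall e : R, 0 < e -> exists N : nat, forall m n : nat,
  (N <= m)%N -> (N <= n)%N -> dot (u m - u n) (u m - u n) < e.
  move=> e e0; exists (Num.bound `|4 / e|) => m n Nm Nn.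
  have small k : (Num.bound `|4 / e| <= k)%N -> k.+1%:R^-1 < e / 4.
    move=> Nk; rewrite -[e / 4]invf_div ltf_pV2 ?posrE ?divr_gt0 //.
    by apply: lt_trans (lt_natr_bound _) _; rewrite ltr_nat.
  have [Mm hm] := hu m; have [Mn hn] := hu n.
  have hb := lbE _ (MZ 2^-1 _ (MD _ _ Mm Mn)).
  have := small _ Nm; have := small _ Nn.
  (* The parallelogram law: as the midpoint lies in M, the right side is below
     [2 / m.+1 + 2 / n.+1]. *)
  have : sqn (u m - u n) = 2 * sqn (x - u m) + 2 * sqn (x - u n)
     - 4 * sqn (x - 2^-1 *: (u m + u n)).
    by rewrite !sqnB sqnZ sqnD !dotE; lra.
  rewrite -[X in X < e]/(sqn (u m - u n)) => -> E1 E2; move: hm hn E1 E2.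
  by set p := m.+1%:R^-1; set q := n.+1%:R^-1; lra.
have [l hl] := rh_complete cau.
have ul : cvg_to u l by [].
have Ml : M l by apply: Mcl ul => n; case: (hu n).
have dl : sqn (x - l) <= inf E.
  apply/ler_addgt0Pl => e e0.
  (* The index shift makes every term, not only the late ones, satisfy the bound [inf E + e]. *)
  apply: (@cvg_to_sqn (fun n => x - u (n + Num.bound `|e^-1|)%N)).
    apply: cvg_toD; first exact: cvg_to_cst.
    move=> d d0; have [N hN] := ul _ d0; exists N => n Nn.
    by rewrite -opprD sqnN; apply: hN; apply: leq_trans Nn (leq_addr _ _).
  move=> n; have [_ /ltW hn] := hu (n + Num.bound `|e^-1|)%N.
  apply: le_trans hn _; rewrite addrC lerD2r.
  rewrite invf_ple ?posrE //; apply: le_trans (ltW (lt_natr_bound _)) _.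
  by rewrite ler_nat; apply: leq_trans (leq_addl _ _) (leqnSn _).
exists l => // z Mz.
have [z0|z0] := eqVneq (sqn z) 0; first by rewrite (sqn_eq0 z0) dot0r.
have zp : 0 < sqn z by rewrite lt_neqAle eq_sym z0 sqn_ge0.
(* Compare l with its translate along z that is nearest to x. *)
have := lbE _ (MD _ _ Ml (MZ (dot (x - l) z / sqn z) _ Mz)).
rewrite opprD addrA sqnB sqnZ dotZr.
set a := dot _ z; set s := sqn z => h.
have e1 : a / s * a = a ^+ 2 / s by rewrite expr2 mulrAC.
have e2 : (a / s) ^+ 2 * s = a ^+ 2 / s by field.
have : a ^+ 2 / s <= 0 by rewrite e1 e2 in h; lra.
rewrite pmulr_lle0 ?invr_gt0 // => a0.
by apply/eqP; rewrite -sqrf_eq0 eq_le a0 sqr_ge0.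
Qed.

End InnerProduct.

(** * The positive square root of [1 - Z] for [0 <= Z <= 1] *)

Section SquareRoot.
Variables (R : realType) (V : real_hilbert R) (Z : V -> V).
Local Notation dot := (@rh_dot R V).
Implicit Types (x y z : V) (F G B : V -> V).
Hypothesis adjZZ : adj Z Z.
Hypothesis formZ : forall x, 0 <= dot (Z x) x <= sqn x.

(* [pospoly F a]: F is a polynomial in Z with nonnegative coefficients of sum a. *)
Inductive pospoly : (V -> V) -> R -> Prop :=
| pospoly_monom a i : 0 <= a -> pospoly (fun x => a *: iter i Z x) a
| pospoly_add F G a b : pospoly F a -> pospoly G b ->
    pospoly (fun x => F x + G x) (a + b)
| pospoly_ext F G a : pospoly F a -> F =1 G -> pospoly G a.

Lemma pospoly_eq F G a b : pospoly F a -> F =1 G -> a = b -> pospoly G b.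
Proof. by move=> h e <-; exact: pospoly_ext h e. Qed.

Lemma pospoly_adj F a : pospoly F a -> adj F F.
Proof.
elim=> [{}a i _|{}F G {}a b _ hF _ hG|{}F G {}a _ hF e] x y.
- by rewrite dotZl dotZr (adj_iter i adjZZ).
- by rewrite dotDl dotDr hF hG.
- by rewrite -!e hF.
Qed.

Lemma pospoly_comm F a B Bs : pospoly F a -> adj B Bs ->
  (forall x, B (Z x) = Z (B x)) -> forall x, B (F x) = F (B x).
Proof.
move=> hF hB hc; elim: hF => [{}a i _|{}F G {}a b _ hF _ hG|{}F G {}a _ hF e] x.
- by rewrite (adjZ hB); congr (_ *: _); elim: i => //= i <-.
- by rewrite (adjD hB) hF hG.
- by rewrite -!e hF.
Qed.

Lemma pospoly_comp F G a b : pospoly F a -> pospoly G b -> pospoly (F \o G) (a * b).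
Proof.
move=> hF hG; elim: hF => [{}a i a0|{}F F' {}a c _ hF _ hF'|{}F F' {}a _ hF e].
- elim: hG => [{}b j b0|{}F {}G {}b c _ hF _ hG|{}F {}G {}b _ hF e].
  + apply: pospoly_ext (pospoly_monom (i + j) (mulr_ge0 a0 b0)) _ => x /=.
    by rewrite (adjZ (adj_iter i adjZZ)) scalerA iterD.
  + apply: (pospoly_eq (pospoly_add hF hG)) => [x|] /=; last by rewrite mulrDr.
    by rewrite -scalerDr -(adjD (adj_iter i adjZZ)).
  + by apply: (pospoly_ext hF) => x /=; rewrite e.
- by apply: (pospoly_eq (pospoly_add hF hF')) => //; rewrite mulrDl.
- by apply: (pospoly_ext hF) => x /=; rewrite e.
Qed.

Lemma sqn_Z_le x : sqn (Z x) <= dot (Z x) x.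
Proof.
rewrite -[leRHS]mul1r; apply: (@sqn_form_le _ _ (fun=> True)) => // y _.
by rewrite mul1r.
Qed.

(** Induction in steps of two: self-adjointness turns [dot (iter i.+2 Z x) x] into the form of
    [iter i Z] at [Z x], and [sqn (Z x) <= sqn x]. *)
Lemma iter_form i x : 0 <= dot (iter i Z x) x <= sqn x.
Proof.
have [n] := ubnP i; elim: n i x => // n IH [|[|i]] x ilt.
- by rewrite sqn_ge0 lexx.
- exact: formZ.
- rewrite iterS iterSr adjZZ; have /andP[-> h] := IH i (Z x) (ltnW ilt).
  by have := sqn_Z_le x; have /andP[_] := formZ x; lra.
Qed.

Lemma pospoly_form F a : pospoly F a ->
  0 <= a /\ forall x, 0 <= dot (F x) x <= a * sqn x.
Proof.
elim=> [{}a i a0|{}F G {}a b _ [a0 hF] _ [b0 hG]|{}F G {}a _ [a0 hF] e].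
- split=> // x; have /andP[h1 h2] := iter_form i x.
  by rewrite dotZl mulr_ge0 // ler_wpM2l.
- split=> [|x]; first exact: addr_ge0.
  have /andP[h1 h2] := hF x; have /andP[h3 h4] := hG x.
  by rewrite dotDl addr_ge0 // mulrDl lerD.
- by split=> // x; rewrite -e.
Qed.

(** This is [F ^ 2 <= F] for [0 <= F <= 1]. It turns convergence of quadratic forms into strong
    convergence. *)
Lemma pospoly_sqn F a : pospoly F a -> a <= 1 -> forall x, sqn (F x) <= dot (F x) x.
Proof.
move=> hF a1 x; have [a0 h] := pospoly_form hF.
rewrite -[leRHS]mul1r; apply: (@sqn_form_le _ _ (fun=> True)) => //.
  exact: pospoly_adj hF.
move=> y _; have /andP[-> h2] := h y; have := sqn_ge0 y; nra.
Qed.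

Lemma pospoly_bnd F a : pospoly F a -> a <= 1 -> bnd 1 F.
Proof.
move=> hF a1 x; rewrite mul1r; have := pospoly_sqn hF a1 x.
have [a0 /(_ x)/andP[_ h]] := pospoly_form hF; have := sqn_ge0 x; nra.
Qed.

(* With [Z = 1 - X] this iterates [Y = (Z + Y ^ 2) / 2], whose solution is [Y = 1 - sqrt X]. *)
Fixpoint sqrt_iter k x : V :=
  if k is k.+1 then 2^-1 *: (Z x + sqrt_iter k (sqrt_iter k x)) else 0.
(** The same recursion with Z replaced by 1, hence the coefficient sum of the polynomial
    [sqrt_iter k]. *)
Fixpoint sqrt_val k : R := if k is k.+1 then 2^-1 * (1 + sqrt_val k * sqrt_val k) else 0.

Lemma pospolyZ c F a : 0 <= c -> pospoly F a -> pospoly (fun x => c *: F x) (c * a).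
Proof. by move=> c0 hF; exact: pospoly_comp (pospoly_monom 0 c0) hF. Qed.

Lemma sqrt_iter_pos k : pospoly (sqrt_iter k) (sqrt_val k).
Proof.
elim: k => [|k IH].
  by apply: (pospoly_ext (pospoly_monom 0 (lexx 0))) => x; rewrite scale0r.
have half_ge0 : 0 <= 2^-1 :> R by rewrite invr_ge0.
apply: (pospolyZ half_ge0); apply: pospoly_add (pospoly_comp IH IH).
by apply: (pospoly_ext (pospoly_monom 1 ler01)) => x; rewrite scale1r.
Qed.

Lemma sqrt_val_ge0 k : 0 <= sqrt_val k.
Proof. by have [] := pospoly_form (sqrt_iter_pos k). Qed.

Lemma sqrt_val_le1 k : sqrt_val k <= 1.
Proof.
elim: k => [|k IH] /=; first exact: ler01.
have := sqrt_val_ge0 k; nra.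
Qed.

(** Writing Y for the iterates and D for [Y_(k+1) - Y_k], the next difference is half of
    [D Y_(k+1) + Y_k D], so nonnegative coefficients propagate. *)
Lemma sqrt_iter_step k :
  pospoly (fun x => sqrt_iter k.+1 x - sqrt_iter k x) (sqrt_val k.+1 - sqrt_val k).
Proof.
elim: k => [|k IH].
  apply: (pospoly_eq (sqrt_iter_pos 1)) => [x|] /=; by rewrite subr0.
have half_ge0 : 0 <= 2^-1 :> R by rewrite invr_ge0.
have h1 := pospoly_comp IH (sqrt_iter_pos k.+1).
have h2 := pospoly_comp (sqrt_iter_pos k) IH.
apply: (pospoly_eq (pospolyZ half_ge0 (pospoly_add h1 h2))) => [x|]; last first.
  by rewrite [sqrt_val k.+2]/=; set v := sqrt_val k; rewrite [sqrt_val k.+1]/= -/v; lra.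
have Yadd := adjB (pospoly_adj (sqrt_iter_pos k)).
rewrite /comp Yadd -[sqrt_iter k.+2 x]/(2^-1 *: (Z x + sqrt_iter k.+1 (sqrt_iter k.+1 x))).
rewrite -[in RHS]/(sqrt_iter k.+1 x).
set w := sqrt_iter k.+1 (sqrt_iter k.+1 x).
rewrite addrA subrK -[sqrt_iter k.+1 x in RHS]/(2^-1 *: (Z x + sqrt_iter k (sqrt_iter k x))).
by rewrite -scalerBr opprD addrACA subrr add0r.
Qed.

Lemma sqrt_iter_diff j k : (j <= k)%N ->
  pospoly (fun x => sqrt_iter k x - sqrt_iter j x) (sqrt_val k - sqrt_val j).
Proof.
move/subnK <-; elim: (k - j)%N => [|m IH]; rewrite ?addSn ?add0n.
  apply: (pospoly_eq (pospoly_monom 0 (lexx 0))) => [x|]; last by rewrite subrr.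
  by rewrite scale0r subrr.
apply: (pospoly_eq (pospoly_add (sqrt_iter_step (m + j)) IH)) => [x|].
  by rewrite addrA subrK.
by rewrite addrA subrK.
Qed.

Lemma sqrt_diff_le1 j k : sqrt_val k - sqrt_val j <= 1.
Proof. have := sqrt_val_le1 k; have := sqrt_val_ge0 j; lra. Qed.

(** The forms [a k] increase and are bounded by [sqn x], and [pospoly_sqn] bounds the squared
    distance of two iterates by the difference of their forms. *)
Lemma sqrt_iter_cvg x : exists l, cvg_to (sqrt_iter^~ x) l.
Proof.
pose a k := dot (sqrt_iter k x) x.
have diffa j k : (j <= k)%N ->
  sqn (sqrt_iter k x - sqrt_iter j x) <= a k - a j /\ 0 <= a k - a j.
  move=> jk; have h := sqrt_iter_diff jk.
  have := pospoly_sqn h (sqrt_diff_le1 j k) x; rewrite dotDl dotNl => h1.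
  by split=> //; apply: le_trans h1; exact: sqn_ge0.
have mono j k : (j <= k)%N -> a j <= a k.
  by move=> /diffa[_]; rewrite subr_ge0.
have ub k : a k <= sqn x.
  have [_ /(_ x)/andP[_ h]] := pospoly_form (sqrt_iter_pos k).
  have := sqrt_val_le1 k; have := sqn_ge0 x; rewrite /a; nra.
apply: rh_complete => e e0; have e4 : 0 < e / 4 by lra.
have [N hN] := nondecreasing_cauchy mono ub e4.
exists N => m n Nm Nn.
rewrite -[dot _ _]/(sqn (sqrt_iter m x - sqrt_iter n x)).
have -> : sqrt_iter m x - sqrt_iter n x =
  (sqrt_iter m x - sqrt_iter N x) + (sqrt_iter N x - sqrt_iter n x).
  by rewrite addrA subrK.
apply: le_lt_trans (sqnD_le _ _) _; rewrite [X in _ + 2 * X]sqn_distC.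
have [h1 _] := diffa _ _ Nm; have [h2 _] := diffa _ _ Nn.
have := hN _ Nm; have := hN _ Nn; lra.
Qed.

(** The root is [1 - Y] for the strong limit Y: the fixed point equation [2 Y = Z + Y ^ 2] says
    [(1 - Y) ^ 2 = 1 - Z]. Operators commuting with Z commute with every iterate, hence with the
    limit. *)
Lemma sqrt_exists : exists S : V -> V,
  [/\ adj S S, forall x, 0 <= dot (S x) x, forall x, S (S x) = x - Z x
    & forall B Bs c, 0 <= c -> adj B Bs -> bnd c B ->
        (forall x, B (Z x) = Z (B x)) -> forall x, B (S x) = S (B x)].
Proof.
have [Y hY] := choice sqrt_iter_cvg.
have adjY : adj Y Y.
  move=> x y; rewrite [RHS]dotC; apply: cvg_to_dot_sym (hY x) (hY y) _ => n.
  by rewrite (pospoly_adj (sqrt_iter_pos n)) dotC.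
exists (fun x => x - Y x); split.
- by move=> x y; rewrite !dotE adjY.
- move=> x; rewrite dotDl dotNl subr_ge0; apply: (cvg_to_dot (hY x)) => n.
  have [_ /(_ x)/andP[_ h]] := pospoly_form (sqrt_iter_pos n).
  have := sqrt_val_le1 n; have := sqn_ge0 x; rewrite -/(sqn x); nra.
- move=> x.
  (* The iterates are contractions, so replacing the inner [sqrt_iter n x] by [Y x] costs an error
     tending to 0. *)
  have YY : cvg_to (fun n => sqrt_iter n (sqrt_iter n x)) (Y (Y x)).
    have h1 : cvg_to (fun n => sqrt_iter n (sqrt_iter n x) - sqrt_iter n (Y x)) 0.
      apply: (@cvg_to_bnd _ _ (sqrt_iter^~ x) _ (Y x) _ 1) (hY x) => // n.
      rewrite subr0 -(adjB (pospoly_adj (sqrt_iter_pos n))).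
      exact: pospoly_bnd (sqrt_iter_pos n) (sqrt_val_le1 n) _.
    have := cvg_toD h1 (hY (Y x)); rewrite add0r.
    by apply: cvg_to_ext => n; rewrite subrK.
  have shift : cvg_to (fun n => sqrt_iter n.+1 x) (Y x).
    move=> e /(hY x)[N hN]; exists N => n Nn.
    by apply: hN; exact: leqW.
  have := cvg_toZ 2^-1 (cvg_toD (cvg_to_cst (Z x)) YY).
  move/(cvg_to_uniq shift) => e.
  apply: dot_inj => w; have := congr1 (dot^~ w) e.
  by rewrite (adjB adjY) !dotE; lra.
- move=> B Bs c c0 hB bB hc x; rewrite (adjB hB); congr (_ - _).
  apply: cvg_to_uniq (cvg_to_op c0 hB bB (hY x)) _.
  apply: cvg_to_ext (hY (B x)) => n /=.
  by rewrite (pospoly_comm (sqrt_iter_pos n) hB hc).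
Qed.
End SquareRoot.

(** * Growth subspaces of a normal operator *)

Section SpectralSubspace.
Variables (R : realType) (V : real_hilbert R).
Local Notation dot := (@rh_dot R V).
Implicit Types (x y z : V) (T Ts A As : V -> V).

(** Paranormality with both sides squared. *)
Definition para T := forall x, sqn (T x) ^+ 2 <= sqn (T (T x)) * sqn x.

(** The self-adjoint D kills the range of A, so [As D = 0]; the kernel condition gives [A D = 0].
    Hence [D ^ 2 = 0], and so [D = 0]. *)
Lemma normal_of_quasinormal A As : adj A As ->
  (forall x, As (A (A x)) = A (As (A x))) -> (forall x, As x = 0 -> A x = 0) ->
  forall x, As (A x) = A (As x).
Proof.
move=> hA qA ker x; have hAs := adjC hA.
pose D y := As (A y) - A (As y).
have adjD : adj D D.
  by move=> y z; rewrite /D !dotE hAs hA hA hAs.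
have DA y : D (A y) = 0 by rewrite /D qA subrr.
have AsD y : As (D y) = 0.
  by apply: dot_inj => z; rewrite dot0l hAs adjD DA dot0r.
have DD y : D (D y) = 0.
  by rewrite /D AsD ker ?AsD // (adj0 hA) (adj0 hAs) subrr.
apply/eqP; rewrite -subr_eq0; apply/eqP/sqn_eq0.
by rewrite -/(D x) /sqn adjD DD dot0r.
Qed.

Lemma sqn_normal A As : adj A As -> (forall x, As (A x) = A (As x)) ->
  forall x, sqn (As x) = sqn (A x).
Proof. by move=> hA nA x; rewrite (sqn_adj hA) (sqn_adj (adjC hA)) nA. Qed.

Lemma normal_para A As : adj A As -> (forall x, As (A x) = A (As x)) -> para A.
Proof.
move=> hA nA x; rewrite {1}(sqn_adj hA); apply: le_trans (cauchy_schwarz _ _) _.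
by rewrite (sqn_normal hA nA).
Qed.

Lemma para_iter T x s : para T -> 0 < s -> 0 < sqn x -> s * sqn x <= sqn (T x) ->
  forall k, s ^+ k * sqn x <= sqn (iter k T x).
Proof.
move=> pT s0 x0 h; apply: (logconvex_geometric (a := fun k => sqn (iter k T x))) => //.
by move=> k /=; exact: pT.
Qed.

Lemma sqn_gt0P x : x = 0 \/ 0 < sqn x.
Proof.
have [/sqn_eq0|x0] := eqVneq (sqn x) 0; first by left.
by right; rewrite lt_neqAle eq_sym x0 sqn_ge0.
Qed.

(** A first ratio [sqn (T x) / sqn x] above t would persist along the orbit and push
    [sqn (iter n T x)] above [t ^+ n * sqn x]. *)
Lemma para_root_le T Ts n t x : adj T Ts -> para T -> (0 < n)%N -> 0 < t ->
  sqn (iter n T x) <= t ^+ n * sqn x -> sqn (T x) <= t * sqn x.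
Proof.
move=> hT pT n0 t0 h; case: (sqn_gt0P x) => [->|x0].
  by rewrite (adj0 hT) sqn0 mulr0.
rewrite -ler_pdivrMr // leNgt; apply/negP => lt_s.
have s0 : 0 < sqn (T x) / sqn x by apply: lt_trans lt_s.
have := @para_iter T x _ pT s0 x0; rewrite divfK ?gt_eqF // => /(_ (lexx _) n).
move=> /le_trans/(_ h); rewrite ler_pM2r // leNgt => /negP; apply.
by rewrite ltrXn2r ?ltW // -lt0n.
Qed.

(* For normal A this is the spectral subspace of A for the disk of radius [sqrt l]. *)
Definition specsub A (l : R) x := exists C, forall m, sqn (iter m A x) <= C * l ^+ m.

(** A first ratio above l would make the orbit outgrow [C * l ^+ m] for any C. *)
Lemma specsub_le A As l x : adj A As -> para A -> 0 < l -> specsub A l x ->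
  sqn (A x) <= l * sqn x.
Proof.
move=> hA pA l0 [C hC]; case: (sqn_gt0P x) => [->|x0].
  by rewrite (adj0 hA) sqn0 mulr0.
rewrite -ler_pdivrMr // leNgt; apply/negP => lt_s.
have s0 : 0 < sqn (A x) / sqn x by apply: lt_trans lt_s.
have := @para_iter A x _ pA s0 x0; rewrite divfK ?gt_eqF // => /(_ (lexx _)) h.
have [k] : exists k, C / sqn x < (sqn (A x) / sqn x / l) ^+ k.
  by apply: exp_unbounded; rewrite ltr_pdivlMr // mul1r.
rewrite expr_div_n ltr_pdivrMr // mulrAC ltr_pdivlMr ?exprn_gt0 //.
by rewrite ltNge (le_trans (h k)).
Qed.

Lemma specsub_mono A l l' x : 0 <= l <= l' -> specsub A l x -> specsub A l' x.
Proof.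
move=> /andP[l0 ll'] [C hC]; exists C => m; apply: le_trans (hC m) _.
apply: ler_wpM2l; last by rewrite lerXn2r ?nnegrE // (le_trans l0).
by have := hC 0%N; rewrite expr0 mulr1; apply: le_trans; exact: sqn_ge0.
Qed.

Lemma specsub_bnd A c x : 0 <= c -> bnd c A -> specsub A c x.
Proof.
move=> c0 bA; exists (sqn x) => m.
by rewrite mulrC; exact: bnd_iter.
Qed.

Lemma specsub0 A As l : adj A As -> specsub A l 0.
Proof.
by move=> hA; exists 0 => m; rewrite (adj0 (adj_iter m hA)) sqn0 mul0r.
Qed.

Lemma specsubD A As l x y : adj A As ->
  specsub A l x -> specsub A l y -> specsub A l (x + y).
Proof.
move=> hA [C hC] [D hD]; exists (2 * C + 2 * D) => m.
rewrite (adjD (adj_iter m hA)); apply: le_trans (sqnD_le _ _) _.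
by have := hC m; have := hD m; move: (l ^+ m) => t; lra.
Qed.

Lemma specsubZ A As l a x : adj A As -> specsub A l x -> specsub A l (a *: x).
Proof.
move=> hA [C hC]; exists (a ^+ 2 * C) => m.
by rewrite (adjZ (adj_iter m hA)) sqnZ -[leRHS]mulrA ler_wpM2l ?sqr_ge0.
Qed.

Lemma iter_comm T A : (forall x, A (T x) = T (A x)) ->
  forall m x, iter m A (T x) = T (iter m A x).
Proof. by move=> h m x; elim: m => //= m ->. Qed.

Lemma specsub_comm A T c l x : 0 <= c -> bnd c T -> (forall x, A (T x) = T (A x)) ->
  specsub A l x -> specsub A l (T x).
Proof.
move=> c0 bT cAT [C hC]; exists (c * C) => m.
by rewrite (iter_comm cAT); apply: le_trans (bT _) _; rewrite -mulrA ler_wpM2l.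
Qed.

Lemma normal_iter A As : (forall x, As (A x) = A (As x)) ->
  forall m x, iter m As (iter m A x) = iter m A (iter m As x).
Proof.
move=> nA m x; rewrite (iter_comm (fun y => esym (iter_comm (fun z => esym (nA z)) m y))).
by [].
Qed.

(** [Ts] commutes with [As], and normality gives [iter m A z] and [iter m As z] the same norm, so
    growth may be measured with [As]. *)
Lemma specsub_comm_adj A As T Ts c l x : 0 <= c -> adj A As ->
  (forall x, As (A x) = A (As x)) -> adj T Ts -> bnd c T ->
  (forall x, A (T x) = T (A x)) -> specsub A l x -> specsub A l (Ts x).
Proof.
move=> c0 hA nA hT bT cAT [C hC]; exists (c * C) => m.
have cTs z : As (Ts z) = Ts (As z).
  apply: dot_inj => y; rewrite (adjC hA) (adjC hT) -cAT.
  by rewrite -(adjC hA) -(adjC hT).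
have q z : sqn (iter m A z) = sqn (iter m As z).
  by rewrite (sqn_normal (adj_iter m hA) (normal_iter nA m)).
rewrite q (iter_comm cTs).
apply: le_trans (bnd_adj c0 hT bT _) _.
by rewrite -q -mulrA ler_wpM2l.
Qed.

(** By [specsub_le] the members [u n] obey the growth bound with constant [sqn (u n)], which stays
    bounded along the sequence. *)
Lemma specsub_closed A As c l u x : 0 <= c -> adj A As -> bnd c A -> para A -> 0 < l ->
  (forall n, specsub A l (u n)) -> cvg_to u x -> specsub A l x.
Proof.
move=> c0 hA bA pA l0 hu ux.
have hle n : forall m, sqn (iter m A (u n)) <= l ^+ m * sqn (u n).
  elim=> [|m IH]; first by rewrite expr0 mul1r.
  rewrite iterS exprS -mulrA.
  have : specsub A l (iter m A (u n)).
    elim: m {IH} => //= m; exact: (specsub_comm c0 bA).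
  move/(specsub_le hA pA l0)/le_trans; apply.
  by rewrite ler_pM2l.
exists (2 + 2 * (2 * sqn x + 2)) => m.
have lm : 0 < l ^+ m by rewrite exprn_gt0.
have cm : 0 <= c ^+ m by rewrite exprn_ge0.
(* The index depends on m: it makes [c ^+ m * sqn (u n - x)] at most [l ^+ m]. *)
have [|N1 h1] := ux (l ^+ m / (c ^+ m + 1)); first by rewrite divr_gt0 //; lra.
have [N2 h2] := ux 1 ltr01.
have := h1 _ (leq_maxl N1 N2); have := h2 _ (leq_maxr N1 N2).
move: (maxn N1 N2) => n q2; rewrite ltr_pdivlMr; last lra; move=> q1.
have e1 : iter m A x = iter m A (x - u n) + iter m A (u n).
  by rewrite -(adjD (adj_iter m hA)) subrK.
have e2 : u n = (u n - x) + x by rewrite subrK.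
rewrite e1; apply: le_trans (sqnD_le _ _) _.
have b1 := bnd_iter c0 bA m (x - u n); rewrite sqn_distC in b1.
have b2 := hle n m.
have b3 := sqnD_le (u n - x) x; rewrite -e2 in b3.
have s0 := sqn_ge0 (u n - x).
have b4 : sqn (iter m A (x - u n)) <= l ^+ m by nra.
have b5 : sqn (iter m A (u n)) <= l ^+ m * (2 * sqn x + 2).
  by apply: le_trans b2 _; rewrite ler_pM2l //; lra.
nra.
Qed.

(* With [S = |G|] the operator [N = S - G] satisfies [G N = - S N], so its range,
   which A preserves, consists of vectors on which [A* A <= l]. Hence N maps
   everything into [specsub A l], so [N y = 0] and [G y = |G| y] for y orthogonal
   to [specsub A l]. *)
Lemma specsub_orth_ge A As c l y : 0 <= c -> adj A As -> bnd c A ->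
  (forall x, As (A x) = A (As x)) -> 0 < l ->
  (forall z, specsub A l z -> dot y z = 0) -> l * sqn y <= sqn (A y).
Proof.
move=> c0 hA bA nA l0 hy; have hAs := adjC hA.
(* The factor a makes G a contraction, so that [Z = 1 - G ^ 2] lies between 0 and 1. *)
pose a : R := (2 * c ^+ 2 + 2 * l ^+ 2 + 1)^-1.
pose G x := a *: (As (A x) - l *: x).
have d0 : 0 < 2 * c ^+ 2 + 2 * l ^+ 2 + 1.
  by have := sqr_ge0 c; have := sqr_ge0 l; lra.
have a0 : 0 < a by rewrite invr_gt0.
have adjG : adj G G.
  by move=> x z; rewrite /G !dotE hAs hA.
have dotG x : dot (G x) x = a * (sqn (A x) - l * sqn x).
  by rewrite /G !dotE hAs.
have bG : bnd 1 G.
  move=> x; rewrite mul1r /G sqnZ.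
  have h1 : sqn (As (A x)) <= c * (c * sqn x).
    by apply: le_trans (bnd_adj c0 hA bA _) _; rewrite ler_wpM2l.
  have h2 := sqnD_le (As (A x)) (- (l *: x)); rewrite sqnN sqnZ in h2.
  have h3 := sqn_ge0 x.
  have h4 : sqn (As (A x) - l *: x) <= a^-1 * sqn x by rewrite invrK; lra.
  have a1 : a <= 1 by rewrite invf_le1 //; have := sqr_ge0 c; have := sqr_ge0 l; lra.
  have h5 : a * sqn (As (A x) - l *: x) <= sqn x.
    by rewrite -ler_pdivlMl.
  rewrite expr2 -mulrA; have := sqn_ge0 (As (A x) - l *: x); nra.
have cGA x : A (G x) = G (A x).
  by rewrite /G (adjZ hA) (adjB hA) (adjZ hA) -nA.
pose Z x := x - G (G x).
have adjZZ : adj Z Z.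
  by move=> x z; rewrite /Z dotDl dotDr dotNl dotNr !adjG.
have formZ x : 0 <= dot (Z x) x <= sqn x.
  rewrite /Z dotDl dotNl adjG -/(sqn x) -/(sqn (G x)).
  by have := bG x; have := sqn_ge0 (G x); rewrite mul1r => ? ?; apply/andP; split; lra.
have [S [adjS posS SS commS]] := sqrt_exists adjZZ formZ.
have SSG x : S (S x) = G (G x) by rewrite SS /Z opprB addrC subrK.
have cSG x : G (S x) = S (G x).
  by apply: (commS _ _ _ ler01 adjG bG) => {}x; rewrite /Z (adjB adjG).
have cSA x : A (S x) = S (A x).
  by apply: (commS _ _ _ c0 hA bA) => {}x; rewrite /Z (adjB hA) !cGA.
pose N x := S x - G x.
have adjN : adj N N.
  by move=> x z; rewrite /N dotDl dotDr dotNl dotNr adjS adjG.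
have cNA x : A (N x) = N (A x) by rewrite /N (adjB hA) cSA cGA.
(* Up to the factor a, the difference of the two sides is [dot (G (N x)) (N x) = - dot (S (N x)) (N
   x)]. *)
have AN x : sqn (A (N x)) <= l * sqn (N x).
  have GN : G (N x) = - S (N x).
    by rewrite /N (adjB adjG) (adjB adjS) cSG SSG opprB.
  rewrite -subr_le0 -(pmulr_rle0 _ a0) -dotG GN dotNl oppr_le0.
  exact: posS.
have specN x : specsub A l (N x).
  exists (sqn (N x)); elim=> [|m IH]; first by rewrite expr0 mulr1.
  rewrite iterS (iter_comm cNA); apply: le_trans (AN _) _.
  by rewrite exprS mulrCA ler_pM2l // -(iter_comm cNA).
(* [sqn (N y)] equals [dot y (N (N y))], and y is orthogonal to the range of N. *)
have : sqn (N y) = 0 by rewrite /sqn adjN hy.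
move/sqn_eq0/eqP; rewrite subr_eq0 => /eqP Sy.
have := posS y; rewrite Sy dotG pmulr_rge0 //; lra.
Qed.

Lemma specsub_projection A As c l : 0 <= c -> adj A As -> bnd c A -> para A -> 0 < l ->
  forall x, exists2 y, specsub A l y & forall z, specsub A l z -> dot (x - y) z = 0.
Proof.
move=> c0 hA bA pA l0; apply: projection.
- exact: specsub0 hA.
- by move=> x y; exact: specsubD hA.
- by move=> a x; exact: specsubZ hA.
- by move=> u x; exact: specsub_closed hA bA pA l0.
Qed.

End SpectralSubspace.

(** * Paranormal roots of normal operators are quasinormal *)

Section ParanormalRoots.
Variables (R : realType) (V : real_hilbert R).
Local Notation dot := (@rh_dot R V).
Implicit Types (x y z : V) (T Ts A As : V -> V).

Definition comm_defect T Ts x := Ts (T (T x)) - T (Ts (T x)).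

(** On K the operator [B = t - Ts T] satisfies [0 <= B <= d], so its norm is at most d. The defect
    is [T B - B T], because the scalar t commutes with T. *)
Lemma comm_defect_le (K : V -> Prop) T Ts t d : adj T Ts -> 0 < t -> 0 < d ->
  (forall x, K x -> K (T x)) -> (forall x, K x -> K (Ts x)) ->
  (forall x y, K x -> K y -> K (x + y)) -> (forall a x, K x -> K (a *: x)) ->
  (forall x, K x -> sqn (T x) <= t * sqn x <= sqn (T x) + d * sqn x) ->
  forall x, K x -> sqn (comm_defect T Ts x) <= 4 * t * d ^+ 2 * sqn x.
Proof.
move=> hT t0 d0 KT KTs KD KZ hK x Kx; have hTs := adjC hT.
pose B y := t *: y - Ts (T y).
have KN y : K y -> K (- y) by move=> Ky; rewrite -scaleN1r; exact: KZ.
have KB y : K y -> K (B y).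
  by move=> Ky; apply: KD; [exact: KZ | apply/KN/KTs/KT].
have adjBB : adj B B.
  by move=> y z; rewrite /B !(dotDl, dotDr, dotNl, dotNr, dotZl, dotZr) hTs hT.
have formB y : K y -> 0 <= dot (B y) y <= d * sqn y.
  move=> /hK; rewrite /B dotDl dotNl dotZl -(sqn_adj hT) -/(sqn y).
  by move=> /andP[h1 h2]; apply/andP; split; lra.
have sqnB_le y : K y -> sqn (B y) <= d ^+ 2 * sqn y.
  move=> Ky; have /andP[_ h] := formB _ Ky.
  have : sqn (B y) <= d * dot (B y) y.
    apply: (sqn_form_le d0 adjBB KB) => // z Kz.
    by apply: KD => //; apply/KN/KZ/KB.
  by move/le_trans; apply; rewrite expr2 -mulrA ler_pM2l.
have -> : comm_defect T Ts x = T (B x) - B (T x).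
  rewrite /comm_defect /B (adjB hT) (adjZ hT).
  by apply: dot_inj => z; rewrite !(dotDl, dotNl); lra.
apply: le_trans (sqnD_le _ _) _; rewrite sqnN.
have /andP[h1 _] := hK _ (KB _ Kx); have /andP[h2 _] := hK _ Kx.
have h3 := sqnB_le _ Kx; have h4 := sqnB_le _ (KT _ Kx).
have d2 : 0 < d ^+ 2 by rewrite exprn_gt0.
have h5 : t * sqn (B x) <= t * (d ^+ 2 * sqn x) by rewrite ler_pM2l.
have h6 : d ^+ 2 * sqn (T x) <= d ^+ 2 * (t * sqn x) by rewrite ler_pM2l.
lra.
Qed.

Variables (T Ts : V -> V) (c : R) (n : nat).
Hypotheses (c0 : 0 < c) (hT : adj T Ts) (bT : bnd c T) (pT : para T) (n0 : (0 < n)%N).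
Let A := iter n T.
Let As := iter n Ts.
Hypothesis nA : forall x, As (A x) = A (As x).

Let hA : adj A As. Proof. exact: adj_iter. Qed.
Let bA : bnd (c ^+ n) A. Proof. exact: bnd_iter (ltW c0) bT n. Qed.
Let cn0 : 0 <= c ^+ n. Proof. exact: exprn_ge0 (ltW c0). Qed.
Let pA : para A. Proof. exact: normal_para hA nA. Qed.

(** Indexed by the bound for T: there [sqn (T x) <= t * sqn x], by [T_le]. *)
Let M t := specsub A (t ^+ n).

Let M_T t x : M t x -> M t (T x).
Proof.
by apply: specsub_comm (ltW c0) bT _ => y; rewrite /A -iterS iterSr.
Qed.

Let M_Ts t x : M t x -> M t (Ts x).
Proof.
by apply: specsub_comm_adj (ltW c0) hA nA hT bT _ => y; rewrite /A -iterS iterSr.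
Qed.

Let T_le t x : 0 < t -> M t x -> sqn (T x) <= t * sqn x.
Proof.
move=> t0 Mx; apply: (para_root_le hT pT n0 t0).
by apply: (specsub_le hA pA _ Mx); rewrite exprn_gt0.
Qed.

(* In squared norms: [A = T ^ n] expands by [(r t) ^ n] while T contracts by t, so T expands by [r ^ n t]. *)
Let T_ge t r x : 0 < t -> 0 < r -> M t x ->
  (forall z, M (r * t) z -> dot x z = 0) -> r ^+ n * t * sqn x <= sqn (T x).
Proof.
move=> t0 r0 Mx hx.
have := specsub_orth_ge cn0 hA bA nA (exprn_gt0 n (mulr_gt0 r0 t0)) hx.
have -> : A x = iter n.-1 T (T x) by rewrite -iterSr prednK.
have it k y : M t y -> M t (iter k T y) /\ sqn (iter k T y) <= t ^+ k * sqn y.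
  move=> My; elim: k => [|k [IH1 IH2]]; first by rewrite expr0 mul1r.
  split; first exact: M_T.
  by apply: le_trans (T_le t0 IH1) _; rewrite exprS -mulrA ler_pM2l.
have [_ h1] := it n.-1 _ (M_T Mx).
move=> /le_trans/(_ h1); rewrite exprMn -[in t ^+ n](prednK n0) exprSr.
have tn : 0 < t ^+ n.-1 by rewrite exprn_gt0.
move=> h3; rewrite -(ler_pM2l tn); apply: le_trans h3.
by rewrite [leLHS](_ : _ = r ^+ n * (t ^+ n.-1 * t) * sqn x) //; ring.
Qed.

(** Split x into its projection u on [M (r * t)] and [x - u]. The bound is assumed for u; on the
    complement [Ts T] lies between [r ^+ n * t] and t, so [comm_defect_le] applies. Both pieces
    reduce T, so the defects are orthogonal and e does not grow. *)
Lemma comm_defect_step t r e : 0 < t -> 0 < r < 1 ->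
  4 * t * (t * (1 - r ^+ n)) ^+ 2 <= e ->
  (forall x, M (r * t) x -> sqn (comm_defect T Ts x) <= e * sqn x) ->
  forall x, M t x -> sqn (comm_defect T Ts x) <= e * sqn x.
Proof.
move=> t0 /andP[r0 r1] he IH x Mx.
have rt0 : 0 < r * t by rewrite mulr_gt0.
have rn1 : r ^+ n < 1 by rewrite exprn_ilt1 ?ltW // -lt0n.
have [u Mu hu] := specsub_projection cn0 hA bA pA (exprn_gt0 n rt0) x.
have Mtu : M t u.
  apply: specsub_mono Mu; apply/andP; split; first exact: exprn_ge0 (ltW rt0).
  by rewrite lerXn2r ?nnegrE ?(ltW rt0) ?(ltW t0) // ltW // gtr_pMl.
pose K v := M t v /\ forall z, M (r * t) z -> dot v z = 0.
have hTs := adjC hT.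
have KT v : K v -> K (T v).
  by move=> [Mv hv]; split=> [|z Mz]; [exact: M_T | rewrite hT; apply/hv/M_Ts].
have KTs v : K v -> K (Ts v).
  by move=> [Mv hv]; split=> [|z Mz]; [exact: M_Ts | rewrite hTs; apply/hv/M_T].
have KD v w : K v -> K w -> K (v + w).
  move=> [Mv hv] [Mw hw]; split=> [|z Mz]; first exact: specsubD hA _ _.
  by rewrite dotDl hv // hw // addr0.
have KZ a v : K v -> K (a *: v).
  move=> [Mv hv]; split=> [|z Mz]; first exact: specsubZ hA _.
  by rewrite dotZl hv // mulr0.
have Kxu : K (x - u).
  split=> //; apply: specsubD hA Mx _.
  by rewrite -scaleN1r; exact: specsubZ hA _.
have KB v : K v -> K (comm_defect T Ts v).
  move=> Kv; apply: KD; first exact/KTs/KT/KT.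
  by rewrite -scaleN1r; apply/KZ/KT/KTs/KT.
have d0 : 0 < t * (1 - r ^+ n) by rewrite mulr_gt0 // subr_gt0.
have hK v : K v -> sqn (T v) <= t * sqn v <= sqn (T v) + t * (1 - r ^+ n) * sqn v.
  move=> [Mv hv]; rewrite T_le //=; have := T_ge t0 r0 Mv hv; lra.
have dv := comm_defect_le hT t0 d0 KT KTs KD KZ hK Kxu.
have dv' : sqn (comm_defect T Ts (x - u)) <= e * sqn (x - u).
  by apply: le_trans dv _; rewrite ler_wpM2r // sqn_ge0.
have Du : M (r * t) (comm_defect T Ts u).
  apply: specsubD hA _ _; first exact/M_Ts/M_T/M_T.
  by rewrite -scaleN1r; apply: specsubZ hA _; exact/M_T/M_Ts/M_T.
have ex : x = (x - u) + u by rewrite subrK.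
have eD : comm_defect T Ts x = comm_defect T Ts (x - u) + comm_defect T Ts u.
  rewrite {1}ex /comm_defect !(adjD hT, adjD hTs).
  by apply: dot_inj => z; rewrite !(dotDl, dotNl); lra.
have [_ orth] := KB _ Kxu.
(* Pythagoras, for the defects and for x itself. *)
rewrite eD sqnD orth // {2}ex sqnD hu //.
have := IH _ Mu; lra.
Qed.

Lemma root_quasinormal x : Ts (T (T x)) = T (Ts (T x)).
Proof.
apply/eqP; rewrite -subr_eq0 -/(comm_defect T Ts x); apply/eqP/sqn_eq0.
case: (sqn_gt0P x) => [->|x0].
  by rewrite /comm_defect !(adj0 hT, adj0 (adjC hT)) subrr sqn0.
apply/eqP; rewrite eq_le sqn_ge0 andbT; apply/ler_addgt0Pl => e' e'0; rewrite addr0.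
have [e [e0 ->]] : exists e, 0 < e /\ e' = e * sqn x.
  by exists (e' / sqn x); rewrite divr_gt0 // divfK // gt_eqF.
(* The ratio [1 - h] of consecutive radii. *)
have [h [h0 h1 hc]] : exists h : R,
  [/\ 0 < h, h < 1 & 4 * c ^+ 3 * (n%:R * h) ^+ 2 <= e].
  pose b := 4 * c ^+ 3 * n%:R ^+ 2.
  have b0 : 0 <= b by rewrite !mulr_ge0 ?exprn_ge0 // ltW.
  have d0 : 0 < b + e + 1 by lra.
  exists (e / (b + e + 1)); split; first by rewrite divr_gt0.
    by rewrite ltr_pdivrMr //; lra.
  set h := e / _.
  have hh : h * (b + e + 1) = e by rewrite divfK // gt_eqF.
  have h0 : 0 < h by rewrite divr_gt0.
  have h1 : h < 1 by rewrite ltr_pdivrMr //; lra.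
  have -> : 4 * c ^+ 3 * (n%:R * h) ^+ 2 = b * h * h by rewrite /b; ring.
  have bh : 0 <= b * h by rewrite mulr_ge0 // ltW.
  nra.
have r01 : 0 < 1 - h < 1 by apply/andP; split; lra.
have /andP[r0 r1] := r01.
have pow1 k : 0 < (1 - h) ^+ k <= 1.
  by rewrite exprn_gt0 //= exprn_ile1 // ltW.
have gap0 : 0 <= 1 - (1 - h) ^+ n by have /andP[_] := pow1 n; lra.
have gap : 1 - (1 - h) ^+ n <= n%:R * h by apply: one_minus_exp; rewrite !ltW.
have nh0 : 0 <= n%:R * h by rewrite mulr_ge0 // ltW.
have gap2 : (1 - (1 - h) ^+ n) ^+ 2 <= (n%:R * h) ^+ 2 by rewrite lerXn2r.
(* The number of radii: the innermost bound [t = (1 - h) ^+ k * c] then satisfies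
   [4 * t ^+ 3 <= e]. *)
have [k hk] : exists k, (1 - h) ^+ k < e / (4 * c ^+ 3).
  by apply: exp_small; rewrite // divr_gt0 // mulr_gt0 // exprn_gt0.
rewrite ltr_pdivlMr in hk; last by rewrite mulr_gt0 // exprn_gt0.
have c3 : 0 < c ^+ 3 by rewrite exprn_gt0.
have cube (s : R) : 0 < s <= 1 -> s ^+ 3 <= s.
  by move=> /andP[s0 s1]; rewrite -[leRHS]expr1 ler_wiXn2l // ltW.
(* Induction outwards from the smallest radius; at [j = k] the subspace is the whole space. *)
suff H j : (j <= k)%N -> forall y, M ((1 - h) ^+ (k - j) * c) y ->
    sqn (comm_defect T Ts y) <= e * sqn y.
  apply: (H k (leqnn k)); rewrite subnn expr0 mul1r.
  exact: specsub_bnd.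
elim: j => [|j IH] jk y.
  rewrite subn0; set t := _ * c => My.
  have /andP[p0 p1] := pow1 k.
  have t0 : 0 < t by rewrite mulr_gt0.
  (* Innermost subspace: the trivial bound [0 <= Ts T <= t] suffices, hence [d = t]. *)
  have := @comm_defect_le (M t) T Ts t t hT t0 t0 (@M_T t) (@M_Ts t).
  move=> /(_ (fun _ _ => specsubD hA) (fun _ _ => specsubZ _ hA)) H.
  apply: le_trans (H _ y My) _.
    move=> z Mz; rewrite T_le //=; have := sqn_ge0 (T z); lra.
  rewrite ler_wpM2r ?sqn_ge0 //.
  have -> : 4 * t * t ^+ 2 = 4 * c ^+ 3 * ((1 - h) ^+ k) ^+ 3 by rewrite /t; ring.
  have := cube _ (pow1 k); move: hk; move: ((1 - h) ^+ k) => p; nra.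
have e1 : (1 - h) * ((1 - h) ^+ (k - j.+1) * c) = (1 - h) ^+ (k - j) * c.
  by rewrite mulrA -exprS subnSK.
have /andP[p0 p1] := pow1 (k - j.+1)%N.
apply: (comm_defect_step _ r01) => //; first by rewrite mulr_gt0.
  apply: le_trans hc.
  have -> : 4 * ((1 - h) ^+ (k - j.+1) * c) *
      ((1 - h) ^+ (k - j.+1) * c * (1 - (1 - h) ^+ n)) ^+ 2 =
    4 * c ^+ 3 * (((1 - h) ^+ (k - j.+1)) ^+ 3 * (1 - (1 - h) ^+ n) ^+ 2) by ring.
  rewrite ler_pM2l ?mulr_gt0 //; apply: le_trans gap2.
  rewrite ler_piMl ?sqr_ge0 //.
  by apply: le_trans (cube _ (pow1 _)) _.
by rewrite e1; apply: IH; exact: ltnW.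
Qed.

End ParanormalRoots.

(** * Passage to the underlying real Hilbert space, and the conclusion *)

Section Realification.
Variables (R : realType) (H : hilbert_space R).

(** A separate name, so that the real scalar action does not clash with the complex one. *)
Definition realified : Type := hs_car H.
HB.instance Definition _ := GRing.Zmodule.on realified.

Definition rscale (a : R) (x : realified) : realified := (a%:C)%C *: (x : hs_car H).

Lemma rscaleA a b x : rscale a (rscale b x) = rscale (a * b) x.
Proof. by rewrite /rscale scalerA rmorphM. Qed.
Lemma rscale1 : left_id 1 rscale.
Proof. by move=> x; rewrite /rscale rmorph1 scale1r. Qed.
Lemma rscaleDr : right_distributive rscale +%R.
Proof. by move=> a x y; exact: scalerDr. Qed.
Lemma rscaleDl x : {morph rscale^~ x : a b / a + b}.
Proof. by move=> a b; rewrite /rscale rmorphD scalerDl. Qed.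

HB.instance Definition _ := GRing.Zmodule_isLmodule.Build R realified
  rscaleA rscale1 rscaleDr rscaleDl.

Definition redot (x y : realified) : R := complex.Re (hs_ip (x : hs_car H) y).

Lemma redotP (a : R) (x y z : realified) :
  redot (a *: x + y) z = a * redot x z + redot y z.
Proof.
rewrite /redot [hs_ip _ z](hs_ipDl (a%:C)%C).
by case: (hs_ip x z) => ? ?; case: (hs_ip y z) => ? ? /=; ring.
Qed.

Lemma redotC (x y : realified) : redot y x = redot x y.
Proof. by rewrite /redot hs_ipC; case: (hs_ip _ _). Qed.

Lemma redot_ge0 (x : realified) : 0 <= redot x x.
Proof. by have := hs_ip_ge0 (x : hs_car H); rewrite lecE => /andP[]. Qed.

Lemma redot_eq0 (x : realified) : redot x x = 0 -> x = 0.
Proof.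
move=> h; apply: hs_ip_eq0; have := hs_ip_ge0 (x : hs_car H).
rewrite lecE => /andP[/eqP im _].
by move: h im; rewrite /redot; case: (hs_ip _ _) => a b /= -> ->.
Qed.

Lemma hnorm_sqr (x : hs_car H) : hnorm x ^+ 2 = redot x x.
Proof. by rewrite sqr_sqrtr // redot_ge0. Qed.

Lemma hnorm_ge0 (x : hs_car H) : 0 <= hnorm x.
Proof. exact: sqrtr_ge0. Qed.

(** Completeness of H is stated with norms and here with squared norms, hence [e ^+ 2] one way and
    [Num.sqrt e] the other. *)
Lemma redot_complete (u : nat -> realified) :
  (forall e : R, 0 < e -> exists N : nat, forall m n : nat,
    (N <= m)%N -> (N <= n)%N -> redot (u m - u n) (u m - u n) < e) ->
  exists l : realified, forall e : R, 0 < e -> exists N : nat, forall n : nat,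
    (N <= n)%N -> redot (u n - l) (u n - l) < e.
Proof.
move=> hu; have [|l hl] := @hs_complete R H u.
  move=> e e0; have [|N hN] := hu (e ^+ 2); first by rewrite exprn_gt0.
  exists N => m n Nm Nn; rewrite -(ltr_pXn2r (n := 2)) ?nnegrE ?sqrtr_ge0 ?ltW //.
  by have := hN _ _ Nm Nn; rewrite -hnorm_sqr.
exists l => e e0; have [|N hN] := hl (Num.sqrt e); first by rewrite sqrtr_gt0.
by exists N => n /hN; rewrite ltr_sqrt.
Qed.

Definition realification : real_hilbert R :=
  RealHilbert redotP redotC redot_ge0 redot_eq0 redot_complete.

End Realification.

Theorem theorem5p4 (R : realType) (H : hilbert_space R) (T Ts : hs_car H -> hs_car H) (n : nat) :
  bounded_op T -> is_adjoint T Ts ->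
  coquasiposinormal T Ts ->
  paranormal T ->
  (0 < n)%N -> quasinormal (iter n T) (iter n Ts) ->
  normal T Ts.
Proof.
move=> [_ [M hM]] hadj ker hP n0 hq.
pose V := realification H; pose rT : V -> V := T; pose rTs : V -> V := Ts.
have hT : adj rT rTs by move=> x y; congr complex.Re; exact: hadj.
(* M may have any sign; [M ^+ 2 + 1] is a positive bound for the squared norm. *)
have bT : bnd (M ^+ 2 + 1) rT.
  move=> x; rewrite /sqn -![rh_dot _ _]hnorm_sqr.
  have := hM x; have := hnorm_ge0 (T x); have := hnorm_ge0 x.
  set a := hnorm x; set b := hnorm (T x) => a0 b0 ab.
  have : b ^+ 2 <= (M * a) ^+ 2 by rewrite lerXn2r ?nnegrE // (le_trans b0).
  have := sqr_ge0 a; rewrite exprMn; lra.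
have pT : para rT.
  move=> x; rewrite /sqn -![rh_dot _ _]hnorm_sqr -exprMn.
  by rewrite lerXn2r ?nnegrE ?mulr_ge0 ?exprn_ge0 ?hnorm_ge0 //; exact: hP.
have kerT x : rTs x = 0 -> rT x = 0 by exact: ker.
have c0 : 0 < M ^+ 2 + 1 by have := sqr_ge0 M; lra.
(* The kernel condition passes to powers: if [Ts (Ts y) = 0] then [T (Ts y) = 0], so [Ts y = 0].
   Thus the kernel of [iter n Ts] lies in that of [Ts], hence in that of T. *)
have kerTn x : iter n rTs x = 0 -> iter n rT x = 0.
  have inj y : rTs (rTs y) = 0 -> rTs y = 0.
    by move/kerT => h; apply: sqn_eq0; rewrite (sqn_adj (adjC hT)) h dot0l.
  have injn k y : iter k.+1 rTs y = 0 -> rTs y = 0.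
    by elim: k => //= k IH /inj.
  rewrite -[n](prednK n0) => /injn/kerT h.
  by rewrite iterSr h (adj0 (adj_iter _ hT)).
have nA x : iter n rTs (iter n rT x) = iter n rT (iter n rTs x).
  apply: (normal_of_quasinormal (adj_iter n hT)) => // y.
  by apply/eqP; rewrite -subr_eq0; apply/eqP; exact: hq.
(* The same lemma, now for T itself, reduces normality to quasinormality of T. *)
move=> x; apply: esym; apply: (normal_of_quasinormal hT) => // y.
exact: (root_quasinormal c0 hT bT pT n0 nA).
Qed.
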